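(* The following statements are equivalent: (1) For the linear space $\mathbb R$ over the field $\mathbb Q$ there is a partition of $\mathbb R\setminus\{0\}$ into countably many linearly independent subsets over $\mathbb Q$. (2) For the extension $\mathbb R$ of the field $\mathbb Q$ there is a partition of $\mathbb R\setminus\{0\}$ into countably many algebraically independent subsets over $\mathbb Q$. (3) For the abelian group $\mathbb R$ there is a partition of $\mathbb R\setminus\{0\}$ into countably many independent subsets. (4) The Continuum Hypothesis is true.
   Context: A subset $A$ of a group $G$ is called independent if there is no $a\in A$ with $a\in\langle A\setminus\{a\}\rangle$, where $\langle B\rangle$ denotes the subgroup of $G$ generated by $B$; in (3), $\mathbb R$ is regarded as a group under addition. The Continuum Hypothesis is the statement $2^{\aleph_0}=\aleph_1$.
   Formalization: In (2) the set partitioned is the set of real numbers transcendental over ℚ instead of ℝ∖{0}: a nonzero algebraic number such as 1 lies in no algebraically independent set, so (2) as printed is always false. *)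

(* Defs.v *)
From HB Require Import structures.
From mathcomp Require Import all_boot all_order all_algebra.
From mathcomp Require Import all_classical all_reals.
From mathcomp Require wochoice.
From mathcomp Require Import -(notations) mpoly.

Set Implicit Arguments.
Unset Strict Implicit.
Unset Printing Implicit Defensive.

Import Order.TTheory GRing.Theory Num.Theory.

Local Open Scope classical_set_scope.
Local Open Scope ring_scope.
Local Open Scope card_scope.

(* "Countably many" allows finitely many; the blocks are nonempty. *)
Definition has_countable_partition (T : Type) (P : set T -> Prop) (X : set T) :=
  exists F : set (set T),
    [/\ countable F, partition F id X & forall A, F A -> P A].

Definition linearly_independent (R : realType) (A : set R) :=
  forall (n : nat) (x : 'I_n -> R) (c : 'I_n -> rat),
    injective x -> (forall i, A (x i)) ->
    \sum_(i < n) ratr (c i) * x i = 0 -> forall i, c i = 0.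

(* [mmap ratr x p] is the value of the rational polynomial [p] at the
   real point [x]. *)
Definition algebraically_independent (R : realType) (A : set R) :=
  forall (n : nat) (x : 'I_n -> R) (p : mpoly n rat),
    injective x -> (forall i, A (x i)) ->
    mmap ratr x p = 0 -> p = 0.

Definition generated_subgroup (V : zmodType) (B : set V) : set V :=
  smallest [set H : set V | GRing.zmod_closed (mem H)] B.

Definition independent (V : zmodType) (A : set V) :=
  ~ exists2 a, A a & generated_subgroup (A `\ a) a.

Definition algebraic_numbers (R : realType) : set R :=
  [set x | algebraicOver (ratr : rat -> R) x].

Arguments algebraic_numbers R : clear implicits.

(* An algebraic real lies in no algebraically independent set; this is why
   algebraically independent sets can only be asked to cover the complement of
   [algebraic_numbers R], and not the complement of 0: no partition of the
   latter into algebraically independent sets exists. *)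
Lemma algebraically_independent_transcendental (R : realType) (A : set R) :
  algebraically_independent A -> A `<=` ~` algebraic_numbers R.
Proof.
move=> indA x Ax [p p_neq0 /eqP px0].
pose q : mpoly 1 rat := (map_poly (@mpolyC 1 rat) p).[mpolyX rat (mnm1 ord0)].
have evalq (S : comNzRingType) (f : {rmorphism rat -> S}) (h : 'I_1 -> S) :
    mmap f h q = (map_poly f p).[h ord0].
  rewrite /q; elim/poly_ind: (p) => [|r c IHr].
    by rewrite !rmorph0 !horner0 mmap0.
  rewrite !rmorphD !rmorphM /= !map_polyX !map_polyC !hornerE mmapD.
  by rewrite (mmap_is_multiplicative h f).1 IHr mmapX mmap1U mmapC.
have q0 : q = 0.
  apply: (indA 1%N (fun=> x)) => [i j _|//|]; last by rewrite evalq.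
  by rewrite [i]ord1 [j]ord1.
move/eqP: p_neq0; apply.
have := evalq _ (@polyC rat) (fun=> 'X).
by rewrite q0 mmap0 -/(comp_poly _ _) comp_polyXr.
Qed.

(* [W], ordered by [r], has order type omega_1: it is well-ordered and
   uncountable, but all its initial segments are countable. *)
Definition order_type_omega1 (W : eqType) (r : rel W) :=
  [/\ wochoice.well_order r, ~ countable [set: W] &
      forall x, countable [set y | r y x]].

(* 2 ^ aleph_0 = aleph_1, where aleph_1 is the cardinality of omega_1. *)
Definition continuum_hypothesis :=
  exists2 W : eqType, (exists r : rel W, order_type_omega1 r) &
    [set: nat -> bool] #= [set: W].

(* Main.v *)
Require Import Defs.
From mathcomp Require Import all_boot all_order all_algebra.
From mathcomp Require Import all_classical all_reals.
From mathcomp Require wochoice.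
From mathcomp Require Import -(notations) mpoly.
From mathcomp Require Import lra.

(** The three kinds of partition are compared with the Continuum Hypothesis
    one by one, after the argument of Erdos and Kakutani.

    From a partition to the hypothesis.  Algebraic independence implies linear
    independence, which implies independence in the additive group, and an
    independent set contains no parallelogram: no four distinct points with
    [x1 - x2 = x3 - x4].  A partition thus yields a colouring of the reals by
    natural numbers without monochromatic parallelograms, outside of a
    countable exceptional set: 0 or the algebraic numbers.  Well-order the
    reals, and let [A] be the set of the points with a countable initial
    segment, which is uncountable.  For each real [b] the pigeonhole principle
    gives [a1 != a2] in [A] such that [a1 + b] and [a2 + b] have the same
    colour and are not exceptional.  Two reals [b], [b'] with the same pair and
    the same colour form a monochromatic parallelogram, unless they are equal
    or differ by [a1 - a2] up to sign; so at most three reals share the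
    same data.  Sending [b] to the larger of [a1], [a2] is then a
    countable-to-one map to [A], and ordering the reals by the value of
    that map first gives them the order type omega_1
    ([order_type_omega1_of_coloring]).

    From the hypothesis to a partition.  Enumerated in type omega_1, the
    reals are the union of an increasing chain of countable sets closed under
    given operations: rational linear combinations, or else the field
    operations and the extraction of roots of polynomials.  Call layer of [x]
    the first member of the chain that contains [x], and colour [x] by its rank
    in an enumeration of that member.  Points of the same colour lie in
    distinct layers, so that in a finite set of them the one of highest layer is
    outside of a closed set containing all the others
    ([dispersed_partition]).  A nontrivial linear or algebraic relation
    would express that point by the others. *)

Set Implicit Arguments.
Unset Strict Implicit.
Unset Printing Implicit Defensive.

Import Order.TTheory GRing.Theory Num.Theory.

Local Open Scope classical_set_scope.
Local Open Scope ring_scope.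
Local Open Scope card_scope.

Lemma countableU T (A B : set T) :
  countable A -> countable B -> countable (A `|` B).
Proof.
by move=> cA cB; rewrite -bigcup2E; apply: bigcup_countable => // -[|[]].
Qed.

(** * Well-orders of type omega_1 *)

Section WellOrder.
Variables (T : eqType) (r : rel T).
Hypothesis wo : wochoice.well_order r.

Lemma well_order_min (P : set T) :
  P !=set0 -> exists2 z, P z & forall y, P y -> r z y.
Proof.
move=> [x Px]; have [|z [[Pz minz] _]] := wo (A := fun x => `[< P x >]).
  by exists x; apply/asboolP.
by exists z => [|y Py]; [exact/asboolP | apply: minz; apply/asboolP].
Qed.

Lemma well_order_total : total r.
Proof.
move=> x y; have [|z + minz] := @well_order_min [set z | z = x \/ z = y].
  by exists x; left.
by case=> <-; rewrite minz ?orbT //; [right | left].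
Qed.

Lemma well_order_refl : reflexive r.
Proof. by move=> x; have := well_order_total x x; rewrite orbb. Qed.

Lemma well_order_anti : antisymmetric r.
Proof.
move=> x y /andP[rxy ryx].
have [|z [_ uniqz]] := wo (A := fun z => (z == x) || (z == y)).
  by exists x; rewrite unfold_in eqxx.
transitivity z; [symmetry|]; apply: uniqz; split; rewrite ?unfold_in ?eqxx ?orbT //.
  by move=> u /orP[] /eqP-> //; exact: well_order_refl.
by move=> u /orP[] /eqP-> //; exact: well_order_refl.
Qed.

Lemma well_order_trans : transitive r.
Proof.
move=> y x z rxy ryz.
have [|u + minu] := @well_order_min [set u | [\/ u = x, u = y | u = z]].
  by exists x; apply: Or31.
have [rux ruy ruz] : [/\ r u x, r u y & r u z].
  by split; apply: minu; [apply: Or31 | apply: Or32 | apply: Or33].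
case=> eu; subst u => //.
- by rewrite (well_order_anti (x := x) (y := y)) // rxy.
- by rewrite -(well_order_anti (x := y) (y := z)) // ryz.
Qed.

Lemma well_order_total_neg x y : ~~ r x y -> r y x.
Proof. by have /orP[->|] := well_order_total x y. Qed.

(** If [A] were countable, the least point outside of it would have a countable
    initial segment, namely [A] and itself, and so would belong to [A]. *)
Lemma uncountable_countable_segments :
  ~ countable [set: T] -> ~ countable [set x | countable [set y | r y x]].
Proof.
move=> ncT; set A := [set x | _] => cA; apply: ncT.
have [AT|] := pselect (A = setT); first by rewrite -AT.
move/eqP/setTPn => nA.
have [z nAz minz] := @well_order_min (~` A) nA.
exfalso; apply: nAz.
apply: (@sub_countable _ _ _ (A `|` [set z])).
  apply: subset_card_le => y /= ryz; have [|nAy] := pselect (A y); first by left.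
  by right; apply: well_order_anti; rewrite ryz minz.
exact: countableU.
Qed.

End WellOrder.

Lemma nat_set_min (P : set nat) :
  P !=set0 -> exists2 m, P m & forall n, P n -> (m <= n)%N.
Proof.
move=> [n Pn]; have exP : exists n, `[< P n >] by exists n; apply/asboolP.
case: (ex_minnP exP) => m /asboolP Pm minm.
by exists m => // k Pk; apply/minm/asboolP.
Qed.

(** A set that maps countable-to-one to omega_1 needs no injection into omega_1
    to be recognized as having cardinality at most aleph_1: it gets an order of
    its own, comparing images under [l] first and ordering each fibre as a set
    of natural numbers. *)
Lemma order_type_omega1_of_fibers (T W : eqType) (r : rel W) (l : T -> W) :
    wochoice.well_order r -> ~ countable [set: T] ->
    (forall x, countable [set w | r w (l x)]) ->
    (forall w, countable (l @^-1` [set w])) ->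
  exists r' : rel T, order_type_omega1 r'.
Proof.
move=> wo ncT cr cl.
have /choice[idx idx_inj] w :
    exists f : T -> nat, {in l @^-1` [set w] &, injective f}.
  exact/countable_injP.
pose r' : rel T := fun x y =>
  r (l x) (l y) && ((l x == l y) ==> (idx (l x) x <= idx (l y) y)%N).
exists r'; split=> // [|x].
  apply: wochoice.antisymmetric_well_order => [x y|A [x Ax]].
    move=> /andP[/andP[rxy ixy] /andP[ryx iyx]].
    have exy : l x = l y by apply: (well_order_anti wo); rewrite rxy.
    move: ixy iyx; rewrite exy eqxx /= => ixy iyx.
    apply: (idx_inj (l y)); rewrite ?inE //.
    by apply/eqP; rewrite eqn_leq ixy.
  have [|w [y Ay <-] minw] := @well_order_min _ r wo (l @` [set z | z \in A]).
    by exists (l x), x.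
  have [|_ [z [Az lzy] <-] minz] := @nat_set_min
    (idx (l y) @` [set z | z \in A /\ l z = l y]).
    by exists (idx (l y) y), y.
  exists z; split=> // t At; rewrite /r' lzy minw /=; last by exists t.
  by apply/implyP => /eqP eyt; rewrite -eyt minz //; exists t.
apply: (@sub_countable _ _ _ (\bigcup_(w in [set w | r w (l x)]) l @^-1` [set w])).
  by apply: subset_card_le => y /andP[ryx _]; exists (l y).
exact: bigcup_countable.
Qed.

(** * Colourings without monochromatic parallelograms *)

(** Instead of choosing the [b] in a set of cardinality aleph_2 to contradict
    the pigeonhole principle, the proof lets [b] range over all of [V], and
    reads off an order on [V] from the pair of translates of [b] that share a
    colour. *)
Lemma order_type_omega1_of_coloring (V : zmodType) (E : set V) (chi : V -> nat) :
    ~ countable [set: V] -> countable E ->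
    (forall x1 x2 x3 x4, uniq [:: x1; x2; x3; x4] ->
       {in [:: x1; x2; x3; x4], forall x, ~ E x /\ chi x = chi x1} ->
     x1 - x2 <> x3 - x4) ->
  exists r : rel V, order_type_omega1 r.
Proof.
move=> ncV cE no_par.
have [r wo] := wochoice.well_ordering_principle V.
pose A := [set x | countable [set y | r y x]].
have ncA : ~ countable A by exact: (uncountable_countable_segments wo).
have pair b : exists p : V * V * nat,
    [/\ A p.1.1, A p.1.2, p.1.1 != p.1.2 &
        {in [:: p.1.1 + b; p.1.2 + b], forall x, ~ E x /\ chi x = p.2}].
  pose B := [set a | A a /\ ~ E (a + b)].
  have ncB : ~ countable B.
    move=> cB; apply: ncA.
    apply: (@sub_countable _ _ _ (B `|` [set a | E (a + b)])).
      apply: subset_card_le => a Aa.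
      by have [|] := pselect (E (a + b)); [right | left].
    apply: countableU => //; have /countable_injP[g g_inj] := cE.
    apply/countable_injP; exists (fun a => g (a + b)) => a a'.
    by rewrite !inE => Ea Ea' /g_inj/addIr; apply; rewrite inE.
  apply: contrapT => nop; apply: ncB; apply/countable_injP.
  exists (fun a => chi (a + b)) => a a'; rewrite !inE => -[Aa Ea] [Aa' Ea'] eqchi.
  apply/eqP/negPn/negP => neqa; apply: nop; exists (a, a', chi (a + b)); split=> //=.
  by move=> x; rewrite !inE => /orP[] /eqP->.
have /choice[f fP] := pair.
pose l b := if r (f b).1.1 (f b).1.2 then (f b).1.2 else (f b).1.1.
have lA b : A (l b) by rewrite /l; case: ifP; case: (fP b).
have rl b : r (f b).1.1 (l b) /\ r (f b).1.2 (l b).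
  rewrite /l; case: ifPn => [//|/(well_order_total_neg wo)]; split=> //;
    exact: well_order_refl.
have f_fibre p : countable (f @^-1` [set p]).
  have [[b0 /= fb0]|nf] := pselect (exists b0, f b0 = p); last first.
    apply: (@sub_countable _ _ _ set0) => //.
    by apply: subset_card_le => b fb; apply: nf; exists b.
  (* The four sums are distinct unless [b] is [b0], [b0 + d] or [b0 - d]. *)
  pose d := p.1.1 - p.1.2.
  apply: (@sub_countable _ _ _ [set` [:: b0; b0 + d; b0 - d]]); last first.
    exact/finite_set_countable/finite_seq.
  apply: subset_card_le => b /= fb; rewrite !inE.
  have := fP b; have := fP b0; rewrite fb fb0 => -[_ _ _ m0] [_ _ neq mb].
  apply/negPn/negP; rewrite !negb_or => /and3P[b_b0 bd bd'].
  apply: (no_par (p.1.1 + b) (p.1.2 + b) (p.1.1 + b0) (p.1.2 + b0)).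
  - rewrite /= !inE !negb_or !(inj_eq (addIr _)) !(inj_eq (addrI _)) neq b_b0 /=.
    rewrite !andbT; apply/andP; split.
      apply: contra bd' => /eqP e.
      by rewrite /d opprB addrA eq_sym subr_eq addrC -e addrC.
    apply: contra bd => /eqP e.
    by rewrite /d addrA eq_sym subr_eq addrC -e addrC.
  - move=> x; rewrite !inE => x4.
    have [? ->] : ~ E x /\ chi x = p.2.
      by case/or4P: x4 => /eqP->; [apply: mb|apply: mb|apply: m0|apply: m0];
        rewrite !inE eqxx ?orbT.
    by have [|_ ->] := mb (p.1.1 + b); rewrite ?inE ?eqxx.
  - by rewrite (addrC p.1.2 b) (addrC p.1.2 b0) !addrKA.
apply: (order_type_omega1_of_fibers (l := l) wo) => // w.
have [[b0 /= lb0]|nl] := pselect (exists b0, l b0 = w); last first.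
  apply: (@sub_countable _ _ _ set0) => //.
  by apply: subset_card_le => b fb; apply: nl; exists b.
have cw : countable [set y | r y w] by rewrite -lb0; exact: lA.
(* Both points of the pair of [b] lie below [l b]. *)
apply: (@sub_countable _ _ _
  (\bigcup_(p in ([set y | r y w] `*` [set y | r y w]) `*` [set: nat])
     f @^-1` [set p])).
  by apply: subset_card_le => b <-; exists (f b) => //; have [] := rl b.
by apply: bigcup_countable => //; do 2?[apply: countableX => //].
Qed.

(** * The cardinality of the real line *)

Lemma injective_card_le (T U : Type) (f : T -> U) :
  injective f -> [set: T] #<= [set: U].
Proof.
move=> f_inj; have /unsquash g : $|{injfun [set: T] >-> [set: U]}|.
  by apply/injfunPex; exists f => // x y _ _ /f_inj.
exact: inj_card_le g.
Qed.

Lemma cantor_uncountable : ~ countable [set: nat -> bool].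
Proof.
case/countable_injP => g g_inj.
pose d n := `[< exists2 b, g b = n & ~~ b n >].
case dgd : (d (g d)).
  have /asboolP[b gbd] := dgd.
  by have -> : b = d by [apply: g_inj; rewrite ?in_setT]; rewrite dgd.
have /asboolPn := negbT dgd; apply; exists d => //.
by rewrite dgd.
Qed.

(** Real numbers whose ternary digits are 0 or 1 embed the binary sequences:
    the first differing digit outweighs all the later ones. *)
Section TernarySums.
Variable R : realType.
Implicit Type b : nat -> bool.

Let S b n : R := \sum_(i < n) (b i)%:R / 3 ^+ i.
Let f b := sup (range (S b)).

Let SS b n : S b n.+1 = S b n + (b n)%:R / 3 ^+ n.
Proof. by rewrite /S big_ord_recr. Qed.

Let S_mono b m n : (m <= n)%N -> S b m <= S b n.
Proof.
move=> /subnK <-; elim: (n - m)%N => // k IHk; apply: le_trans IHk _.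
by rewrite addSn SS lerDl divr_ge0 ?exprn_ge0.
Qed.

(* The added constant is the sum of all the later terms when their digits
   are 1. *)
Let S_bound b m n : S b n <= S b m + 3 / 2 / 3 ^+ m.
Proof.
have anti k : S b (m + k)%N + 3 / 2 / 3 ^+ (m + k) <= S b m + 3 / 2 / 3 ^+ m.
  elim: k => [|k IHk]; first by rewrite addn0.
  apply: le_trans IHk; rewrite addnS SS exprSr invfM.
  have : 0 < (3 ^+ (m + k) : R)^-1 by rewrite invr_gt0 exprn_gt0.
  set u := _^-1; case: (b _) => /=; lra.
apply: le_trans (S_mono b (leq_addl m n)) (le_trans _ (anti n)).
by rewrite lerDl !divr_ge0 ?exprn_ge0.
Qed.

Let f_ge b n : S b n <= f b.
Proof.
apply: ub_le_sup; last by exists n.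
by exists (S b 0%N + 3 / 2 / 3 ^+ 0) => _ [k _ <-]; exact: S_bound.
Qed.

Let f_le b n : f b <= S b n + 3 / 2 / 3 ^+ n.
Proof.
apply: ge_sup; first by exists (S b 0%N), 0%N.
by move=> _ [k _ <-]; exact: S_bound.
Qed.

Let f_lt b b' n : (forall i, (i < n)%N -> b i = b' i) -> b n = false ->
  b' n -> f b < f b'.
Proof.
move=> eqb bn b'n; apply: le_lt_trans (f_le b n.+1) (lt_le_trans _ (f_ge b' n.+1)).
have eqS : S b n = S b' n by apply: eq_bigr => i _; rewrite eqb.
rewrite !SS bn b'n eqS exprSr invfM /=.
have : 0 < (3 ^+ n : R)^-1 by rewrite invr_gt0 exprn_gt0.
by set u := _^-1; lra.
Qed.

Lemma card_le_cantor_real : [set: nat -> bool] #<= [set: R].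
Proof.
apply: (@injective_card_le _ _ f) => b b' eqf; apply/funext => n.
elim/ltn_ind: n => n IHn.
case bn : (b n); case b'n : (b' n) => //.
- have := f_lt (fun i lt_in => esym (IHn i lt_in)) b'n bn.
  by rewrite eqf ltxx.
- by have := f_lt IHn bn b'n; rewrite eqf ltxx.
Qed.

(** A real number is determined by the set of rationals below it. *)
Lemma card_le_real_cantor : [set: R] #<= [set: nat -> bool].
Proof.
apply: (@injective_card_le _ _ (fun x n =>
  if unpickle n is Some q then ratr (q : rat) < x else false)) => x y eqxy.
have lt_abs (u v : R) : u < v ->
  (fun n => if unpickle n is Some q then ratr (q : rat) < u else false) <>
  (fun n => if unpickle n is Some q then ratr (q : rat) < v else false).
  case/rat_in_itvoo => q; rewrite in_itv /= => /andP[uq qv].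
  move=> /(congr1 (fun h => h (pickle q))); rewrite pickleK qv.
  by rewrite ltNge (ltW uq).
by have [/lt_abs/(_ eqxy)|/lt_abs/(_ (esym eqxy))|] := ltgtP x y.
Qed.

Lemma card_cantor_real : [set: nat -> bool] #= [set: R].
Proof. by rewrite card_eq_le card_le_cantor_real card_le_real_cantor. Qed.

Lemma real_uncountable : ~ countable [set: R].
Proof. by move/(card_le_trans card_le_cantor_real)/cantor_uncountable. Qed.

End TernarySums.

Lemma continuum_hypothesis_of_real (R : realType) :
  (exists r : rel R, order_type_omega1 r) -> continuum_hypothesis.
Proof. by move=> exr; exists R => //; exact: card_cantor_real. Qed.

(** * Countable partitions as colourings *)

Lemma coloring_of_partition (T : Type) (P : set T -> Prop) (X : set T) :
    has_countable_partition P X ->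
  exists chi : T -> nat, forall x, X x ->
    exists2 A, P A & forall y, X y -> chi y = chi x -> A y.
Proof.
move=> [F [/countable_injP[g g_inj] [coverF _ _] PF]].
have /choice[B FB] x : exists B, X x -> F B /\ B x.
  have [|nXx] := pselect (X x); last by exists set0.
  by rewrite -coverF => -[B FB Bx]; exists B.
exists (g \o B) => x Xx; have [FBx _] := FB x Xx.
exists (B x) => [|y Xy /= eqg]; first exact: PF.
have [FBy By] := FB y Xy.
by rewrite -(g_inj (B y) (B x)) //; exact: mem_set.
Qed.

Lemma partition_of_coloring (T : Type) (P : set T -> Prop) (X : set T)
    (chi : T -> nat) :
  (forall n, P [set x | X x /\ chi x = n]) -> has_countable_partition P X.
Proof.
move=> PX; pose B n := [set x | X x /\ chi x = n].
exists [set A | range B A /\ A !=set0]; split.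
- apply: (@sub_countable _ _ _ (range B)); first by apply: subset_card_le => A [].
  exact: sub_countable (card_image_le B setT) (countableP _).
- split.
  + apply/seteqP; split=> [x [_ [[n _ <-] _] []] //|x Xx].
    by exists (B (chi x)) => //; split; [exists (chi x) | exists x].
  + by move=> _ _ [[n _ <-] _] [[m _ <-] _] [x [[_ <-] [_ <-]]].
  + by move=> A [].
- by move=> _ [[n _ <-] _]; exact: PX.
Qed.

Lemma has_countable_partition_imply (T : Type) (P Q : set T -> Prop) (X : set T) :
  (forall A, P A -> Q A) ->
  has_countable_partition P X -> has_countable_partition Q X.
Proof. by move=> PQ [F [cF pF PF]]; exists F; split=> // A /PF/PQ. Qed.

(** * Colourings by layers *)

(** [D s] is the set of the points obtained from the entries of [s] by one of
    the operations under consideration. *)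

Section Layers.
Variables (T : eqType) (D : seq T -> set T).

Definition closed_under (V : set T) :=
  forall s, (forall x, x \in s -> V x) -> D s `<=` V.

Let hull := smallest closed_under.

Let hull_closed B : closed_under (hull B).
Proof.
move=> s sB x Dsx V [clV BV]; apply: (clV s) => // y ys.
by apply: (sB y ys) => //; split.
Qed.

Let hull_mono B C : B `<=` C -> hull B `<=` hull C.
Proof.
move=> BC; apply: smallest_sub => //; apply: subset_trans BC _.
exact: sub_gen_smallest.
Qed.

Lemma countable_seqs (B : set T) :
  countable B -> countable [set s : seq T | forall x, x \in s -> B x].
Proof.
case/countable_injP => g g_inj; apply/countable_injP.
exists (fun s => pickle (map g s)) => s s'; rewrite !inE /= => sB s'B.
move/(pcan_inj pickleK); elim: s s' sB s'B => [|x s IHs] [|y s'] //= sB s'B [gxy].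
move=> /IHs eqs; congr cons.
  by apply: g_inj => //; apply/mem_set; [apply: sB | apply: s'B]; exact: mem_head.
by apply: eqs => z zs; [apply: sB | apply: s'B]; rewrite in_cons zs orbT.
Qed.

Let countable_hull B :
  (forall s, countable (D s)) -> countable B -> countable (hull B).
Proof.
move=> cD cB.
pose step X := X `|` \bigcup_(s in [set s : seq T | forall x, x \in s -> X x]) D s.
pose it n := iter n step B.
have it_mono m n : (m <= n)%N -> it m `<=` it n.
  by move=> /subnK <-; elim: (n - m)%N => // k IHk x /IHk; left.
apply: (@sub_countable _ _ _ (\bigcup_n it n)).
  apply: subset_card_le; apply: smallest_sub; last by move=> x Bx; exists 0%N.
  move=> s sit x Dsx.
  suff [n sn] : exists n, forall y, y \in s -> it n y.
    by exists n.+1 => //; right; exists s.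
  elim: s sit {x Dsx} => [|y s IHs] sit; first by exists 0%N.
  have [n _ yn] := sit y (mem_head y s).
  have [|m sm] := IHs; first by move=> z zs; apply: sit; rewrite in_cons zs orbT.
  exists (maxn n m) => z; rewrite in_cons => /predU1P[->|zs].
    exact: (it_mono _ _ (leq_maxl _ _)).
  exact: (it_mono _ _ (leq_maxr _ _) _ (sm z zs)).
apply: bigcup_countable => // n _; elim: n => //= n IHn.
apply: countableU => //; apply: bigcup_countable => //.
exact: countable_seqs.
Qed.

(** The common form of independence: the point [x] is independent of the rest
    of [s] because a set closed under the operations separates it from them. *)
Definition dispersed (A : set T) := forall s : seq T,
  s != [::] -> uniq s -> (forall x, x \in s -> A x) ->
  exists x V, [/\ x \in s, closed_under V, ~ V x &
                  forall y, y \in s -> y != x -> V y].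

(** The chain is [L w], the closed set generated by the points enumerated up to
    [w]; [l x] is the layer of [x]. *)
Lemma dispersed_partition (W : eqType) (r : rel W) (e : W -> T) (Z : set T) :
    order_type_omega1 r -> (forall x, exists w, e w = x) ->
    (forall s, countable (D s)) -> closed_under Z ->
  has_countable_partition dispersed (~` Z).
Proof.
move=> [wo _ cr] e_surj cD clZ.
pose L w := hull (e @` [set y | r y w]).
have L_mono v w : r v w -> L v `<=` L w.
  move=> rvw; apply: hull_mono => _ [y ryv <-]; exists y => //.
  exact: (well_order_trans wo ryv).
have L_countable w : countable (L w).
  by apply: countable_hull => //; exact: sub_countable (card_image_le _ _) (cr w).
have /choice[l lP] x : exists w, L w x /\ forall v, L v x -> r w v.
  have [|w Lwx minw] := @well_order_min _ r wo [set w | L w x]; last by exists w.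
  have [w <-] := e_surj x; exists w; apply: sub_gen_smallest.
  by exists w => //; exact: well_order_refl.
have /choice[idx idx_inj] w : exists f : T -> nat, {in L w &, injective f}.
  exact/countable_injP.
apply: (partition_of_coloring (chi := fun x => idx (l x) x)).
move=> n s s_neq0 s_uniq sA.
have [x xs maxx] : exists2 x, x \in s & forall y, y \in s -> r (l y) (l x).
  elim: s s_neq0 {s_uniq sA} => // x [_ _|y s /(_ isT)[z zs maxz] _].
    exists x => [|y]; rewrite inE // => /eqP->; exact: well_order_refl.
  have [rxz|rzx] := orP (well_order_total wo (l x) (l z)).
    by exists z => [|t]; rewrite in_cons ?zs ?orbT // => /predU1P[->|/maxz].
  exists x => [|t]; first exact: mem_head.
  rewrite in_cons => /predU1P[->|/maxz rtz]; first exact: well_order_refl.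
  exact: (well_order_trans wo rtz).
have l_neq y : y \in s -> y != x -> l y != l x.
  move=> ys; apply: contraNneq => eql.
  have [_ iy] := sA y ys; have [_ ix] := sA x xs.
  apply/eqP; apply: (idx_inj (l x)); last by rewrite -{1}eql iy ix.
    by apply: mem_set; rewrite -eql; have [] := lP y.
  by apply: mem_set; have [] := lP x.
(* The first term matters when [l x] is the least element and the union is
   empty. *)
pose V := hull set0 `|` \bigcup_(v in [set v | r v (l x) /\ v != l x]) L v.
exists x, V; split=> //.
- move=> t tV.
  suff [t0|[v vx tv]] : (forall y, y \in t -> hull set0 y) \/
      exists2 v, r v (l x) /\ v != l x & forall y, y \in t -> L v y.
    - by move=> y /(hull_closed t0); left.
    - by move=> y /(hull_closed tv); right; exists v.
  have hull0L v : hull set0 `<=` L v by apply: hull_mono.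
  elim: t tV => [|y t IHt] tV; first by left.
  have [|t0|[v vx tv]] := IHt.
  + by move=> z zt; apply: tV; rewrite in_cons zt orbT.
  + have [y0|[v vx yv]] := tV y (mem_head _ _).
      by left=> z; rewrite in_cons => /predU1P[->|/t0].
    by right; exists v => // z; rewrite in_cons => /predU1P[->|/t0/hull0L].
  + right; have [y0|[u ux yu]] := tV y (mem_head _ _).
      exists v => // z; rewrite in_cons => /predU1P[->|/tv //]; exact: hull0L.
    have [ruv|rvu] := orP (well_order_total wo u v).
      by exists v => // z; rewrite in_cons => /predU1P[->|/tv //]; exact: (L_mono u).
    by exists u => // z; rewrite in_cons => /predU1P[->|/tv] //; exact: (L_mono v).
- case=> [hx|[v [rv nv] Lvx]].
    by have [nZ _] := sA x xs; apply: nZ; apply: hx; split.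
  case/eqP: nv; apply: (well_order_anti wo).
  by rewrite rv; have [_ ->] := lP x.
- move=> y ys nyx; right; exists (l y); last by have [] := lP y.
  by split; [exact: maxx | exact: l_neq].
Qed.

End Layers.

(** * Linear independence *)

Section Linear.
Variable R : realType.

Definition rational_multiples_of_sum (s : seq R) : set R :=
  range (fun q : rat => ratr q * \sum_(x <- s) x).

Lemma dispersed_linearly_independent (A : set R) :
  dispersed rational_multiples_of_sum A -> linearly_independent A.
Proof.
move=> dA n x c x_inj xA sum0.
pose S := [seq i <- enum 'I_n | c i != 0].
have memS i : (i \in S) = (c i != 0) by rewrite mem_filter mem_enum andbT.
suff S0 : S = [::] by move=> i; apply/eqP/negPn; rewrite -memS S0.
apply/eqP/negPn/negP => S_neq0.
have [||_ /mapP[i _ ->] //|_ [V [/mapP[k kS ->] clV nVk Vs]]] := dA (map x S).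
- by case: (S) S_neq0.
- by rewrite map_inj_uniq // filter_uniq // enum_uniq.
apply: nVk; apply: (clV [seq ratr (c i) * x i | i <- enum 'I_n & i != k]).
  move=> _ /mapP[i + ->]; rewrite mem_filter => /andP[nik _].
  have [ci0|ci_neq0] := eqVneq (c i) 0.
    by apply: (clV [::]) => //; exists 0 => //; rewrite ci0 rmorph0 !mul0r.
  apply: (clV [:: x i]); last by exists (c i); rewrite ?big_seq1.
  move=> y; rewrite inE => /eqP->; apply: Vs; last by rewrite (inj_eq x_inj).
  by rewrite map_f // memS.
exists (- (c k)^-1) => //; rewrite big_map big_filter big_enum_cond /=.
move: kS; rewrite memS => ck_neq0.
have rk_neq0 : ratr (c k) != 0 :> R by rewrite fmorph_eq0.
move: sum0; rewrite (bigD1 k) //= => /eqP; rewrite addr_eq0 => /eqP e.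
by rewrite rmorphN fmorphV mulNr -mulrN -e mulKf.
Qed.

Lemma countable_rational_multiples s : countable (rational_multiples_of_sum s).
Proof. exact: sub_countable (card_image_le _ _) (countableP _). Qed.

Lemma rational_multiples_closed0 :
  closed_under rational_multiples_of_sum [set 0].
Proof. by move=> s s0 _ [q _ <-] /=; rewrite big_seq big1 ?mulr0. Qed.

(** The rational combinations of [A `\ a] form a subgroup; if it contained [a],
    moving [a] to the other side would give a relation with coefficient -1. *)
Lemma linearly_independent_independent (A : set R) :
  linearly_independent A -> independent A.
Proof.
move=> indA [a Aa].
pose H : set R := [set y | exists c : R -> rat, exists2 s : seq R,
  uniq s /\ (forall x, x \in s -> (A `\ a) x) & y = \sum_(x <- s) ratr (c x) * x].
have Hgroup : GRing.zmod_closed (mem H).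
  split=> [|y z]; first by apply/mem_set; exists (fun=> 0), [::]; rewrite ?big_nil.
  move=> /set_mem[c [s [us sA] ->]] /set_mem[d [t [ut tA] ->]].
  apply/mem_set; exists (fun x => (if x \in s then c x else 0) -
                                  (if x \in t then d x else 0)).
  have restrict (u v : seq R) (e : R -> rat) : uniq u -> uniq v -> 
      {subset u <= v} ->
      \sum_(x <- v) ratr (if x \in u then e x else 0) * x =
      \sum_(x <- u) ratr (e x) * x.
    move=> uu uv uvS; rewrite (bigID (mem u)) /= [X in _ + X]big1 ?addr0; last first.
      by move=> x /negPf ->; rewrite rmorph0 mul0r.
    rewrite -big_filter (perm_big u) /=.
      by rewrite big_seq [RHS]big_seq; apply: eq_bigr => x ->.
    apply: uniq_perm => //; first exact: filter_uniq.
    by move=> x; rewrite mem_filter; case: (boolP (x \in u)) => // /uvS ->.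
  exists (undup (s ++ t)).
    split=> [|x]; first exact: undup_uniq.
    by rewrite mem_undup mem_cat => /orP[/sA|/tA].
  under [RHS]eq_bigr do rewrite rmorphB mulrBl.
  by rewrite sumrB !restrict ?undup_uniq // => x;
    rewrite mem_undup mem_cat => ->; rewrite ?orbT.
have HA : A `\ a `<=` H.
  move=> x Ax; exists (fun=> 1), [:: x]; last by rewrite big_seq1 rmorph1 mul1r.
  by split=> // y; rewrite inE => /eqP->.
move=> /(_ H (conj Hgroup HA))[c [s [us sA] ea]].
pose d x : rat := if x == a then -1 else c x.
have a_s : a \notin s by apply/negP => /sA[_]; exact.
suff : d (tnth (in_tuple (a :: s)) ord0) = 0.
  by rewrite /d /= eqxx => /eqP; rewrite oppr_eq0 oner_eq0.
pose t := in_tuple (a :: s).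
move: ord0; apply: (indA _ (tnth t) (d \o tnth t)) => [|i|].
- by apply/tuple_uniqP; rewrite /= a_s.
- have := mem_tnth i (in_tuple (a :: s)).
  by rewrite inE => /predU1P[->//|/sA[]].
- rewrite -(big_tnth _ _ _ xpredT (fun x => ratr (d x) * x)) big_cons /d eqxx.
  rewrite rmorphN1 mulN1r {1}ea addrC; apply/eqP; rewrite subr_eq0; apply/eqP.
  rewrite big_seq [RHS]big_seq; apply: eq_bigr => x xs; case: eqP => // xa.
  by rewrite -xa xs in a_s.
Qed.

Lemma independent_no_parallelogram (A : set R) x1 x2 x3 x4 :
  independent A -> uniq [:: x1; x2; x3; x4] ->
  {in [:: x1; x2; x3; x4], forall x, A x} -> x1 - x2 <> x3 - x4.
Proof.
move=> indA; rewrite /= !inE !negb_or => /andP[/and3P[n12 n13 n14] _] As e.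
apply: indA; exists x1; first by apply: As; rewrite mem_head.
move=> H [Hgroup HA]; apply: set_mem.
have mem x : x \in [:: x2; x3; x4] -> x \in H.
  move=> xs; apply/mem_set/HA; split; first by apply: As; rewrite in_cons xs orbT.
  move=> /= xx1; move: xs; rewrite xx1 !inE.
  by rewrite (negPf n12) (negPf n13) (negPf n14).
have HB : forall u v, u \in H -> v \in H -> u - v \in H by exact: Hgroup.2.
have -> : x1 = (x3 - x4) - (0 - x2) by rewrite sub0r opprK -e subrK.
apply: (HB); last apply: (HB); last by apply: mem; rewrite mem_head.
  by apply: HB; apply: mem; rewrite !inE eqxx ?orbT.
exact: Hgroup.1.
Qed.
End Linear.

(** * Algebraic independence *)

Lemma countable_roots (K : idomainType) (p : {poly K}) :
  p != 0 -> countable [set x | root p x].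
Proof.
elim: {p}(size p) {-2}p (leqnn (size p)) => [|n IHn] p.
  by rewrite size_poly_leq0 => ->.
move=> szp p_neq0.
have [[a pa]|nop] := pselect (exists a, root p a); last first.
  apply: (@sub_countable _ _ _ set0) => //.
  by apply: subset_card_le => x px; apply: nop; exists x.
have /factor_theorem[q pE] := pa.
have q_neq0 : q != 0 by apply: contraNneq p_neq0 => q0; rewrite pE q0 mul0r.
apply: (@sub_countable _ _ _ ([set x | root q x] `|` [set a])).
  apply: subset_card_le => x /=; rewrite pE rootM root_XsubC => /orP[|/eqP];
    by [left | right].
apply: countableU => //; apply: IHn => //.
by move: szp; rewrite pE size_mul ?polyXsubC_eq0 // size_XsubC addn2.
Qed.

Section Algebraic.
Variable R : realType.

Lemma countable_algebraic_numbers : countable (algebraic_numbers R).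
Proof.
apply: (@sub_countable _ _ _ (\bigcup_(p in [set p : {poly rat} | p != 0])
   [set x : R | root (map_poly ratr p) x])).
  by apply: subset_card_le => x [p p_neq0 px]; exists p.
apply: bigcup_countable => [|p /= p_neq0]; first exact: (@countableP {poly rat}).
apply: countable_roots.
by rewrite map_poly_eq0.
Qed.

(** The sets closed under these operations are the relatively algebraically
    closed subfields of [R]: inverses and opposites are among the roots and the
    products. *)
Definition algebraic_operations (s : seq R) : set R :=
  range ratr `|` [set \sum_(x <- s) x; \prod_(x <- s) x] `|`
  [set x | Poly s != 0 /\ root (Poly s) x].

Lemma countable_algebraic_operations s : countable (algebraic_operations s).
Proof.
apply: countableU; first apply: countableU.
- exact: sub_countable (card_image_le _ _) (countableP _).
- exact: countableU.
- have [s0|s_neq0] := eqVneq (Poly s) 0.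
    by apply: (@sub_countable _ _ _ set0) => //; apply: subset_card_le => x [].
  apply: (sub_countable _ (countable_roots s_neq0)).
  by apply: subset_card_le => x [].
Qed.

Lemma algebraic_operations_closed_algebraic :
  closed_under algebraic_operations (algebraic_numbers R).
Proof.
move=> s salg x [[[q _ <-]|[->|->]]|[s_neq0 sx]].
- exact: algebraic_id.
- rewrite /= big_seq; elim/big_ind: _ => [|y z|y /salg //]; first exact: algebraic0.
  exact: algebraic_add.
- rewrite /= big_seq; elim/big_ind: _ => [|y z|y /salg //]; first exact: algebraic1.
  exact: algebraic_mul.
- apply/integral_algebraic; apply: (integral_root s_neq0 sx).
  apply/integral_poly => i; apply/integral_algebraic; rewrite coef_Poly.
  have [|si] := ltnP i (size s); first by move/(mem_nth 0)/salg.
  by rewrite nth_default //; exact: algebraic0.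
Qed.

Section Closed.
Variable V : set R.
Hypothesis clV : closed_under algebraic_operations V.

Lemma closed_ratr q : V (ratr q).
Proof. by apply: (clV (s := [::])) => //; left; left; exists q. Qed.

Lemma closed_sum I (s : seq I) (P : pred I) (F : I -> R) :
  (forall i, P i -> V (F i)) -> V (\sum_(i <- s | P i) F i).
Proof.
move=> VF; elim/big_rec: _ => [|i y /VF Vi Vy].
  by rewrite -(rmorph0 (@ratr R)); exact: closed_ratr.
apply: (clV (s := [:: F i; y])); first by move=> z; rewrite !inE => /orP[] /eqP->.
by left; right; left; rewrite big_cons big_seq1.
Qed.

Lemma closed_prod I (s : seq I) (P : pred I) (F : I -> R) :
  (forall i, P i -> V (F i)) -> V (\prod_(i <- s | P i) F i).
Proof.
move=> VF; elim/big_rec: _ => [|i y /VF Vi Vy].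
  by rewrite -(rmorph1 (@ratr R)); exact: closed_ratr.
apply: (clV (s := [:: F i; y])); first by move=> z; rewrite !inE => /orP[] /eqP->.
by left; right; right; rewrite big_cons big_seq1.
Qed.

Lemma closed_root (p : {poly R}) x :
  p != 0 -> root p x -> (forall i, V p`_i) -> V x.
Proof.
move=> p_neq0 px Vp; apply: (clV (s := p)).
  by move=> _ /(nthP 0)[i _ <-]; exact: Vp.
by right; rewrite polyseqK.
Qed.

End Closed.

Lemma mmap_lincomb n (x : 'I_n -> R) (I : Type) (s : seq I) (c : I -> rat)
    (m : I -> multinom n) :
  mmap ratr x (\sum_(i <- s) c i *: mpolyX rat (m i)) =
  \sum_(i <- s) ratr (c i) * mmap1 x (m i).
Proof.
rewrite (big_morph _ (@mmapD _ _ _ _ _) (@mmap0 _ _ _ _ _)).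
by apply: eq_bigr => i _; rewrite mmapZ mmapX.
Qed.

Lemma mcoeff_lincomb n (s : seq (multinom n)) (c : multinom n -> rat) m :
  uniq s -> mcoeff m (\sum_(i <- s) c i *: mpolyX rat i) =
    if m \in s then c m else 0.
Proof.
move=> s_uniq; rewrite (big_morph _ (mcoeffD m) (mcoeff0 _ m)).
have E i : mcoeff m (c i *: mpolyX rat i) = if i == m then c m else 0.
  by rewrite mcoeffZ mcoeffX; case: eqP => [->|_]; rewrite ?mulr1 ?mulr0.
rewrite (eq_bigr _ (fun i _ => E i)); case: ifPn => ms.
  by rewrite (bigD1_seq m) //= eqxx big1 ?addr0 // => i /negPf ->.
by rewrite big1_seq // => i /andP[_ si]; case: eqP => // im; rewrite -im si in ms.
Qed.

Lemma algebraically_independent_linearly_independent (A : set R) :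
  algebraically_independent A -> linearly_independent A.
Proof.
move=> indA n x c x_inj xA sum0 j.
pose p := \sum_(i <- enum 'I_n) c i *: mpolyX rat (mnm1 i).
have p0 : p = 0.
  apply: (indA n x) => //; rewrite mmap_lincomb big_enum /= -[RHS]sum0.
  by apply: eq_bigr => i _; rewrite mmap1U.
have <- : mcoeff (mnm1 j) p = c j; last by rewrite p0 mcoeff0.
rewrite (big_morph _ (mcoeffD _) (mcoeff0 _ _)) big_enum (bigD1 j) //=.
rewrite mcoeffZ mcoeffXU eqxx mulr1 big1 ?addr0 // => i /negPf nij.
by rewrite mcoeffZ mcoeffXU nij mulr0.
Qed.

(** Variables are eliminated one at a time. The point [x k] that is separated
    from the others is a root of the relation read as a polynomial in that
    single variable, whose coefficients lie in a closed set avoiding [x k]; so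
    all these coefficients vanish, and each of them is a relation between
    the remaining points. Substituting 1 for the variables already eliminated
    keeps all the relations in the same polynomial ring; no information is lost
    because their exponents are constant over the monomials of the relation. *)
Lemma dispersed_algebraically_independent (A : set R) :
  dispersed algebraic_operations A -> algebraically_independent A.
Proof.
move=> dA n x p x_inj xA px0.
pose h (S : {set 'I_n}) i : R := if i \in S then x i else 1.
suff main (S : {set 'I_n}) q :
    (forall m1 m2 i, m1 \in msupp q -> m2 \in msupp q -> i \notin S ->
       m1 i = m2 i) ->
    mmap ratr (h S) q = 0 -> q = 0.
  apply: (main finset.setT); first by move=> m1 m2 i _ _; rewrite finset.in_setT.
  rewrite -[RHS]px0; congr mmap; apply/funext => i.
  by rewrite /h finset.in_setT.
(* When no variable is left, the relation has at most one monomial. *)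
elim: {S}#|S| {-2}S (erefl #|S|) q => [|N IHN] S cS q q_agree q0.
  have S0 i : i \notin S by rewrite (card0_eq cS).
  case eqs : (msupp q) => [|m s]; first exact: msuppnil0.
  have s0 : s = [::].
    case: s eqs => // m' s eqs; have := msupp_uniq q.
    rewrite eqs /= inE => /andP[/norP[/eqP nmm' _] _]; case: nmm'.
    by apply/mnmP => i; apply: q_agree => //; rewrite eqs !inE eqxx ?orbT.
  move: q0; rewrite /mmap eqs s0 big_seq1 /mmap1 big1; last first.
    by move=> i _; rewrite /h (negPf (S0 i)) expr1n.
  move=> /eqP; rewrite mulr1 fmorph_eq0 mcoeff_eq0 eqs s0 inE eqxx //.
have [||_ /mapP[i _ ->] //|_ [V [/mapP[k + ->] clV nVk Vs]]] :=
    dA (map x (enum S)).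
- by rewrite -size_eq0 size_map -cardE cS.
- by rewrite map_inj_uniq // enum_uniq.
rewrite mem_enum => kS.
have Vh i : i != k -> V (h S i).
  move=> nik; rewrite /h; case: ifP => iS.
    by apply: Vs; [rewrite map_f // mem_enum | rewrite (inj_eq x_inj)].
  by rewrite -(rmorph1 (@ratr R)); exact: closed_ratr.
pose others (m : multinom n) := \prod_(i < n | i != k) h S i ^+ m i.
have mmap1h m : mmap1 (h S) m = x k ^+ m k * others m.
  by rewrite /mmap1 (bigD1 k) //= {1}/h kS.
(* The relation, read as a polynomial in the variable of index [k]. *)
pose P := \sum_(m <- msupp q) (ratr (mcoeff m q) * others m) *: 'X^(m k).
have coefP j : P`_j = \sum_(m <- msupp q | m k == j) ratr (mcoeff m q) * others m.
  rewrite coef_sum [RHS]big_mkcond /=; apply: eq_bigr => m _.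
  by rewrite coefZ coefXn eq_sym; case: eqP; rewrite ?mulr1 ?mulr0.
have P0 : P = 0.
  apply/eqP/negPn/negP => P_neq0; apply: nVk; apply: (closed_root clV P_neq0).
    rewrite rootE horner_sum -[X in _ == X]q0; apply/eqP.
    by apply: eq_bigr => m _; rewrite hornerZ hornerXn mmap1h mulrAC mulrA.
  move=> j; rewrite coefP; apply: (closed_sum clV) => m _.
  have Vo : V (others m).
    apply: (closed_prod clV) => i /Vh Vi.
    by rewrite -[m i]card_ord -prodr_const; apply: (closed_prod clV).
  have := @closed_prod V clV bool [:: true; false] xpredT
    (fun b => if b then ratr (mcoeff m q) else others m).
  by rewrite big_cons big_seq1; apply=> -[] _ //; exact: closed_ratr.
apply: msuppnil0; case eqs : (msupp q) => [//|m0 s].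
have m0q : m0 \in msupp q by rewrite eqs mem_head.
(* The coefficient of degree [m0 k] of [P] comes from these monomials. *)
pose s0 := [seq m : multinom n <- msupp q | m k == m0 k].
pose q1 := \sum_(m <- s0) mcoeff m q *: mpolyX rat m.
have coefq1 m : mcoeff m q1 = if m \in s0 then mcoeff m q else 0.
  by rewrite mcoeff_lincomb // filter_uniq // msupp_uniq.
have q1_0 : q1 = 0.
  apply: (IHN (S :\ k)%SET) => [|m1 m2 i|].
  - by move: cS; rewrite (finset.cardsD1 k) kS => -[].
  - rewrite !mcoeff_msupp !coefq1 !mem_filter finset.in_setD1 negb_and negbK.
    case: ifP => [/andP[/eqP m1k m1q] _|]; last by rewrite eqxx.
    case: ifP => [/andP[/eqP m2k m2q] _|]; last by rewrite eqxx.
    by case/orP => [/eqP->|iS]; [rewrite m1k m2k | exact: q_agree].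
  - rewrite mmap_lincomb big_filter.
    transitivity P`_(m0 k); last by rewrite P0 coef0.
    rewrite coefP; apply: eq_bigr => m _; congr (_ * _).
    rewrite /mmap1 (bigD1 k) //= {1}/h finset.setD11 expr1n mul1r.
    by apply: eq_bigr => i nik; rewrite /h finset.in_setD1 nik.
have := m0q; rewrite mcoeff_msupp.
by have := coefq1 m0; rewrite q1_0 mcoeff0 mem_filter eqxx m0q /= => <-; rewrite eqxx.
Qed.

End Algebraic.

(** * The equivalence *)

Lemma card_eq_surjection (T U : Type) :
  [set: T] #= [set: U] -> exists f : T -> U, forall y, exists x, f x = y.
Proof.
move=> /card_eqP/unsquash f; exists (fun x => val (f (to_setT x))) => y.
have [x _ fx] : (f @` setT) (to_setT y) by apply: (@surj _ _ _ _ f).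
by exists (val x); rewrite (_ : to_setT (val x) = x) ?fx //; apply: val_inj.
Qed.

Section Equivalence.
Variable R : realType.

Lemma continuum_hypothesis_of_independent_partition (E : set R) :
    countable E -> has_countable_partition (@independent R) (~` E) ->
  continuum_hypothesis.
Proof.
move=> cE /coloring_of_partition[chi chiP].
apply: (@continuum_hypothesis_of_real R).
apply: (order_type_omega1_of_coloring (chi := chi) _ cE).
  exact: real_uncountable.
move=> x1 x2 x3 x4 s_uniq s_mono.
have [A indA chiA] := chiP x1 (s_mono x1 (mem_head _ _)).1.
apply: (independent_no_parallelogram indA s_uniq) => x /s_mono[nEx chix].
exact: chiA.
Qed.

Lemma dispersed_partition_of_continuum_hypothesis (D : seq R -> set R) (Z : set R) :
    (forall s, countable (D s)) -> closed_under D Z -> continuum_hypothesis ->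
  has_countable_partition (dispersed D) (~` Z).
Proof.
move=> cD clZ [W [r omega1_r] W_cantor].
have /card_eq_surjection[e e_surj] : [set: W] #= [set: R].
  by rewrite -(card_eql W_cantor); exact: card_cantor_real.
exact: dispersed_partition omega1_r e_surj cD clZ.
Qed.

End Equivalence.

Theorem theorem4 (R : realType) :
  [<-> has_countable_partition (@linearly_independent R) (~` [set 0]);
       has_countable_partition (@algebraically_independent R)
         (~` algebraic_numbers R);
       has_countable_partition (@independent R) (~` [set 0]);
       continuum_hypothesis].
Proof.
have ch_ind E := @continuum_hypothesis_of_independent_partition R E.
have lin_ind := has_countable_partition_imply
  (@linearly_independent_independent R).
have ch_lin : continuum_hypothesis ->
    has_countable_partition (@linearly_independent R) (~` [set 0]).
  move=> ch; apply: has_countable_partition_imply.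
    exact: dispersed_linearly_independent.
  apply: dispersed_partition_of_continuum_hypothesis ch => //.
    exact: countable_rational_multiples.
  exact: rational_multiples_closed0.
tfae.
- move=> /lin_ind /ch_ind ch; apply: has_countable_partition_imply.
    exact: dispersed_algebraically_independent.
  apply: dispersed_partition_of_continuum_hypothesis (ch _).
  + exact: countable_algebraic_operations.
  + exact: algebraic_operations_closed_algebraic.
  + exact: finite_set_countable.
- move=> alg; apply/lin_ind/ch_lin.
  apply: (ch_ind _ (@countable_algebraic_numbers R)).
  apply/lin_ind; apply: has_countable_partition_imply alg.
  exact: algebraically_independent_linearly_independent.
- by apply: ch_ind; exact: finite_set_countable.
- exact: ch_lin.
Qed.
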